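(* For every $n\in\mathbb{N}_0$ and every $u\in\mathbb{R}$, $$(T\psi_n)(u)=(\psi_0*\psi_n)(u)=\frac{u^n}{\sqrt{n!\,2^n}}\,e^{-\frac{u^2}{4}}.$$
   Context: $\mathbb{N}_0=\{0,1,2,\dots\}$. The Hermite polynomials $H_n$ are defined by $e^{2xz-z^2}=\sum_{n\ge 0}\frac{H_n(x)}{n!}z^n$, the Hermite functions by $h_n(x)=e^{-x^2/2}H_n(x)$, and the normalized Hermite functions by $\psi_n(x)=\frac{h_n(x)}{\sqrt{n!\,2^n\sqrt{\pi}}}$, $x\in\mathbb{R}$. The convolution is $(g*f)(u)=\int_{\mathbb{R}}g(u-x)f(x)\,dx$, and $T$ is the convolution operator $Tf=\psi_0*f$ on $L^2(\mathbb{R})$. *)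

(* Defs.v *)
From HB Require Import structures.
From mathcomp Require Import all_boot all_order all_algebra.
From mathcomp Require Import all_classical all_reals all_analysis.
From mathcomp Require Import measurable_realfun ring lra.

Set Implicit Arguments.
Unset Strict Implicit.
Unset Printing Implicit Defensive.

Import Order.TTheory GRing.Theory Num.Theory.
Import numFieldNormedType.Exports.

Local Open Scope classical_set_scope.
Local Open Scope ring_scope.

(* An everywhere convergent expansion determines its coefficients, so at most
   one sequence satisfies this identity. *)
Definition is_hermite (R : realType) (H : nat -> {poly R}) : Prop :=
  forall x z : R,
    series (fun n => (H n).[x] / n`!%:R * z ^+ n) @ \oo
      --> expR (2 * x * z - z ^+ 2).

Definition hermite_fun (R : realType) (H : nat -> {poly R}) (n : nat) (x : R)
    : R :=
  expR (- (x ^+ 2) / 2) * (H n).[x].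

Definition psi (R : realType) (H : nat -> {poly R}) (n : nat) (x : R) : R :=
  hermite_fun H n x / Num.sqrt (n`!%:R * 2 ^+ n * Num.sqrt pi).

Definition convolution (R : realType) (g f : R -> R) (u : R) : R :=
  \int[lebesgue_measure]_x (g (u - x) * f x).

(* Functions in L^2(R), not quotiented by a.e. equality. *)
Definition L2 (R : realType) : Type :=
  LfunType (@lebesgue_measure R) (lee1n 2).

(* By Cauchy-Schwarz the integral defining convT H f u converges for every f in
   L^2(R) and every u, and it depends only on the a.e. class of f. *)
Definition convT (R : realType) (H : nat -> {poly R}) (f : L2 R) : R -> R :=
  convolution (psi H 0) f.

Section psi_in_L2.
Variables (R : realType) (H : nat -> {poly R}) (n : nat).
Local Notation mu := (@lebesgue_measure R).

Let poly_le_expR (p : {poly R}) :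
  {C : R | forall x, `|p.[x]| <= C * expR (x ^+ 2 / 4)}.
Proof.
exists (expR 1 * \sum_(i < size p) `|p`_i| * i`!%:R) => x.
rewrite horner_coef (le_trans (ler_norm_sum _ _ _))//.
rewrite mulrAC mulr_sumr; apply: ler_sum => i _.
have xi : `|x| ^+ i <= i`!%:R * expR `|x|.
  rewrite -ler_pdivrMl ?ltr0n ?fact_gt0//.
  case: (nat_of_ord i) => [|k].
    by rewrite expr0 fact0 invr1 mulr1 -[leLHS]expR0 ler_expR.
  by have := expR_ge1Dxn k (normr_ge0 x); rewrite [_^-1 * _]mulrC; lra.
have xe : expR `|x| <= expR 1 * expR (x ^+ 2 / 4).
  rewrite -expRD ler_expR -(real_normK (num_real x)).
  by have := sqr_ge0 (`|x| / 2 - 1); lra.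
rewrite normrM normrX mulrCA; apply: ler_wpM2l => //.
by rewrite mulrC; apply: (le_trans xi); exact: ler_wpM2l.
Qed.

Let measurable_psi : measurable_fun setT (psi H n).
Proof.
apply: measurable_funM => //; apply: measurable_funM; last first.
  by apply: continuous_measurable_fun => x; exact: continuous_horner.
apply: measurableT_comp => //; apply: measurable_funM => //.
by apply: measurableT_comp => //; exact: measurable_funX.
Qed.

Let finite_norm_psi : finite_norm mu 2%:E (psi H n).
Proof.
have [C hC] := poly_le_expR (H n).
pose c := Num.sqrt (n`!%:R * 2 ^+ n * Num.sqrt pi) : R.
pose K := C ^+ 2 / c ^+ 2 / normal_peak (1 : R).
have p1 : 0 < normal_peak (1 : R) by rewrite normal_peak_gt0// oner_neq0.
have psi2 x : psi H n x ^+ 2 <= K * normal_pdf 0 1 x.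
  rewrite normal_pdfE ?oner_neq0// /normal_fun subr0 expr1n /K.
  rewrite [leRHS]mulrA divfK ?gt_eqF// /psi -/c expr_div_n.
  rewrite [leRHS]mulrAC ler_wpM2r ?invr_ge0 ?sqr_ge0// /hermite_fun exprMn.
  rewrite -[_.[x] ^+ 2]real_normK ?num_real//.
  have h : `|(H n).[x]| ^+ 2 <= (C * expR (x ^+ 2 / 4)) ^+ 2.
    by rewrite ler_pXn2r// ?nnegrE// (le_trans _ (hC x)).
  apply: le_trans (ler_wpM2l (sqr_ge0 _) h) _.
  rewrite exprMn mulrCA -!expRM_natl -expRD ler_wpM2l ?sqr_ge0// ler_expR.
  by lra.
rewrite /finite_norm unlock /Lnorm poweR_lty//.
under eq_integral => x _ do
  rewrite abse_EFin poweR_EFin powR_mulrn// real_normK ?num_real//.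
have/integrableP[_] : mu.-integrable setT (fun x => (psi H n x ^+ 2)%:E).
  apply: (@le_integrable _ _ _ mu setT _ _
    (fun x => (K * normal_pdf 0 1 x)%:E)) => //.
  - by apply/measurable_EFinP; exact: measurable_funX.
  - move=> x _; rewrite lee_fin ger0_norm ?sqr_ge0//.
    exact: le_trans (ler_norm _).
  - under eq_fun => x do rewrite EFinM.
    by apply: integrableZl => //; exact: integrable_normal_pdf.
apply: le_lt_trans; rewrite le_eqVlt; apply/orP; left; apply/eqP.
by apply: eq_integral => x _; rewrite gee0_abs// lee_fin sqr_ge0.
Qed.

Lemma psi_Lfun : psi H n \in Lfun mu 2%:E.
Proof. by rewrite inE; apply/andP; split; rewrite inE. Qed.

Definition psi_L2 : L2 R := Lfun_Sub (lee1n 2) psi_Lfun.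
End psi_in_L2.

(* Main.v *)
Require Import Defs.
From mathcomp Require Import all_boot all_order all_algebra.
From mathcomp Require Import all_classical all_reals all_analysis.
From mathcomp Require Import measurable_realfun ring lra.

Set Implicit Arguments.
Unset Strict Implicit.
Unset Printing Implicit Defensive.

Import Order.TTheory GRing.Theory Num.Theory.
Import numFieldNormedType.Exports.

Local Open Scope classical_set_scope.
Local Open Scope ring_scope.

(** Completing the square, [(u - x)^2 / 2 + x^2 / 2 = (x - u/2)^2 + u^2 / 4],
    turns the convolution into [exp (- u^2 / 4)], times normalizing constants,
    times the integral of [H_n] against the Gaussian weight
    [exp (- (x - m)^2)] centred at [m = u / 2].  So everything rests on
      [\int exp (- (x - m)^2) H_n(x) dx = sqrt pi * (2 m)^n]
    ([Rintegral_gauss_hermite]), which at [m = u / 2] gives [sqrt pi * u^n].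

    This moment formula comes from the raising relation
    [H_{n+1} = 2 x H_n - H_n'].  The function [exp (- (x - m)^2) H_n] vanishes
    at both infinities, so its derivative
    [exp (- (x - m)^2) (H_n' - 2 (x - m) H_n)] has integral zero
    ([Rintegral_gauss_horner_by_parts]).  Replacing [2 x] by
    [2 (x - m) + 2 m] in the raising relation, only [2 m H_n] survives, and
    each step of the induction contributes a factor [2 m].

    The hypothesis only gives the generating function
    [F(z) = exp (2 x z - z^2)] for each fixed [x].  It satisfies
    [F' = (2 x - 2 z) F].  Comparing coefficients of the everywhere convergent
    power series on both sides ([hermite_coef_rec]) yields the three-term
    recurrence [H_{n+2} = 2 x H_{n+1} - 2 (n + 1) H_n].  The polynomials
    defined by the raising relation satisfy it as well, because
    [H_{n+1}' = 2 (n + 1) H_n] ([deriv_hermite]); hence the two families agree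
    ([is_hermiteE]). *)

(** * Everywhere convergent power series *)

Lemma cvg_pseries0 (R : realType) (c : nat -> R) : pseries c 0 @ \oo --> c 0.
Proof.
rewrite -cvg_shiftS; apply: cvg_near_cst; near=> k.
rewrite /pseries /series/= big_nat_recl// expr0 mulr1 big1 ?addr0// => i _.
by rewrite exprS mul0r mulr0.
Unshelve. all: by end_near. Qed.

(** Since [n + 1 <= 2^n], the factor brought down by differentiation is absorbed
    by doubling the radius, and the series converges there too. *)
Lemma is_cvg_pseries_diffs (R : realType) (c : nat -> R) :
  (forall z, cvgn (pseries c z)) ->
  forall z, cvgn (pseries (pseries_diffs c) z).
Proof.
(* The shift by 1 keeps y nonzero, so that one power of 2y can be divided out. *)
move=> cc z; set y := `|z| + 1.
have y0 : 0 < y by rewrite /y ltr_pwDr.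
(* Absolute convergence at 2y follows from convergence at the larger 3y. *)
have : cvgn (pseries (fun i => `|c i|) (2 * y)).
  apply: (@is_cvg_pseries_inside_norm _ _ (3 * y)) => //.
  by rewrite !ger0_norm ?mulr_ge0 ?ltW//; lra.
rewrite /pseries -(is_cvg_series_restrict 1) => cv.
apply: normed_cvg.
apply: (@series_le_cvg _ _
  (fun n => (2 * y)^-1 * (`|c n.+1| * (2 * y) ^+ n.+1))).
- by move=> n /=.
- by move=> n /=; rewrite !mulr_ge0 ?invr_ge0 ?exprn_ge0 ?mulr_ge0 ?(ltW y0).
- move=> n /=; rewrite /pseries_diffs !normrM normr_nat normrX exprS.
  rewrite [leRHS]mulrCA mulKf ?gt_eqF ?mulr_gt0// mulrAC mulrC.
  apply: ler_wpM2l => //; rewrite exprMn.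
  apply: ler_pM => //.
    by rewrite -natrX ler_nat ltn_expl.
  by apply: lerXn2r; rewrite ?nnegrE ?(ltW y0)// /y lerDl.
- apply: is_cvg_seriesZ.
  rewrite [X in cvgn X](_ : _ = (fun n => \sum_(1 <= k < n.+1)
     `|c k| * (2 * y) ^+ k)).
    by apply/cvg_ex; case/cvg_ex: cv => l cl; exists l;
      rewrite (cvg_shiftS (fun n => \sum_(1 <= k < n) `|c k| * (2 * y) ^+ k)).
  by apply/funext => n; rewrite /series/= big_add1.
Qed.

Lemma is_derive_pseries (R : realType) (c : nat -> R) (F : R -> R) :
  (forall z, pseries c z @ \oo --> F z) ->
  forall z : R, is_derive z (1 : R) F (limn (pseries (pseries_diffs c) z)).
Proof.
move=> cF z.
have cc y : cvgn (pseries c y) by apply/cvg_ex; exists (F y); exact: cF.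
have -> : F = fun y => limn (pseries c y).
  by apply/funext => y; apply/esym/cvg_lim => //; exact: cF.
have cd := is_cvg_pseries_diffs cc.
apply: (@pseries_snd_diffs _ c (`|z| + 1)) => //.
  exact: is_cvg_pseries_diffs.
by rewrite [ltRHS]ger0_norm ?addr_ge0// ltrDl.
Qed.

(** Differentiating shifts the coefficients down (up to a nonzero factor), so
    the value at [0] of the successive derivatives reads off all of them. *)
Lemma pseries_coef_eq0 (R : realType) (c : nat -> R) :
  (forall z, pseries c z @ \oo --> 0) -> forall n, c n = 0.
Proof.
move=> + n; elim: n c => [|n IHn] c c0.
  exact: cvg_unique (@cvg_pseries0 R c) (c0 0).
have /IHn : forall z, pseries (pseries_diffs c) z @ \oo --> 0.
  move=> z.
  have cc y : cvgn (pseries c y) by apply/cvg_ex; exists 0; exact: c0.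
  have [_ h] := is_derive_pseries c0 z.
  move: h; rewrite derive_cst => ->.
  exact: is_cvg_pseries_diffs.
by rewrite /pseries_diffs => /eqP; rewrite mulf_eq0 pnatr_eq0/= => /eqP.
Qed.

Lemma cvg_pseries_mulX (R : realType) (c : nat -> R) (z l : R) :
  pseries c z @ \oo --> l ->
  pseries (fun n => if n is k.+1 then c k else 0) z @ \oo --> z * l.
Proof.
move=> cl; rewrite -cvg_shiftS.
rewrite (_ : [sequence _]_n = fun n => z * pseries c z n).
  exact: cvgMl_tmp.
apply/funext => n; rewrite /pseries /series/= big_nat_recl// mul0r add0r.
by rewrite mulr_sumr; apply: eq_bigr => i _; rewrite exprS mulrCA.
Qed.

(** * Hermite polynomials *)

(** This is the differential equation [F' = (2 x - 2 z) F] of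
    [F(z) = exp (2 x z - z^2)], read on coefficients. *)
Lemma hermite_coef_rec (R : realType) (x : R) (a : nat -> R) :
  (forall z, pseries a z @ \oo --> expR (2 * x * z - z ^+ 2)) ->
  forall n, n.+1%:R * a n.+1 = 2 * x * a n - 2 * (if n is k.+1 then a k else 0).
Proof.
move=> ha n; apply/eqP; rewrite -subr_eq0; apply/eqP; move: n.
pose b n := if n is k.+1 then a k else 0.
apply: (@pseries_coef_eq0 _ (fun n => n.+1%:R * a n.+1 -
  (2 * x * a n - 2 * b n))) => z.
set E := expR (2 * x * z - z ^+ 2).
have dE : is_derive z (1 : R) (fun y => expR (2 * x * y - y ^+ 2))
    (E * (2 * x - 2 * z)).
  (* The exponent is a polynomial in z, whose derivative is computed formally. *)
  pose p := (2 * x) *: 'X - 'X^2 : {poly R}.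
  have -> : (fun y => expR (2 * x * y - y ^+ 2)) = expR \o horner p.
    by apply/funext => y; rewrite /p /= !hornerE.
  have pz : p.[z] = 2 * x * z - z ^+ 2 by rewrite /p !hornerE.
  apply: is_derive_eq.
  rewrite pz -/E /p derivB derivZ derivX derivXn !hornerE.
  by congr (_ * (_ - _)); ring.
have dA : pseries (pseries_diffs a) z @ \oo --> E * (2 * x - 2 * z).
  have [_ <-] := dE; have [_ ->] := is_derive_pseries ha z.
  apply: is_cvg_pseries_diffs => y.
  by apply/cvg_ex; exists (expR (2 * x * y - y ^+ 2)); exact: ha.
have shE : pseries b z @ \oo --> z * E by exact: cvg_pseries_mulX (ha z).
have -> : 0 = E * (2 * x - 2 * z) - (2 * x * E - 2 * (z * E)) by ring.
rewrite (_ : pseries _ z = fun k => pseries (pseries_diffs a) z k -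
    (2 * x * pseries a z k - 2 * pseries b z k)).
  apply: cvgB => //; apply: cvgB; apply: cvgMl_tmp => //; exact: ha.
apply/funext => k.
rewrite /pseries /series/= !mulr_sumr -!sumrB.
apply: eq_bigr => i _; rewrite /pseries_diffs; ring.
Qed.

(** The raising relation [H_{n+1} = 2 x H_n - H_n'] is taken as the definition
    because it is the form that integration by parts uses. *)
Fixpoint hermite (R : realType) (n : nat) : {poly R} :=
  if n is k.+1 then (2 *: 'X) * hermite R k - (hermite R k)^`() else 1.

(** By induction [H_{n+2} = 2 x H_{n+1} - 2 (n + 1) H_n]; in its derivative the
    terms
    [2 x H_{n+1}' - 2 (n + 1) H_n'] reassemble into [2 (n + 1) H_{n+1}] by the
    raising relation. *)
Lemma deriv_hermite (R : realType) n :
  (hermite R n.+1)^`() = (2 * n.+1%:R) *: hermite R n.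
Proof.
elim: n => [|n IHn].
  by rewrite /= derivC subr0 !mulr1 derivZ derivX alg_polyC.
rewrite [hermite R n.+2]/= IHn derivB derivM !derivZ derivX IHn.
rewrite /= -!mul_polyC.
rewrite -(natr1 n.+1) !(polyCM, polyCD); ring.
Qed.

(** Both families obey the same three-term recurrence, so a two-step induction
    identifies them; [a] carries the factorials of the generating series. *)
Lemma is_hermiteE (R : realType) (H : nat -> {poly R}) : is_hermite H ->
  forall n x, (H n).[x] = (hermite R n).[x].
Proof.
move=> hH n x.
pose a n := (H n).[x] / n`!%:R.
have ha z : pseries a z @ \oo --> expR (2 * x * z - z ^+ 2) by exact: hH.
have fact_neq0 k : k`!%:R != 0 :> R by rewrite pnatr_eq0 -lt0n fact_gt0.
have Ha k : (H k).[x] = a k * k`!%:R by rewrite /a divfK.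
suff : a n * n`!%:R = (hermite R n).[x] /\
       a n.+1 * n.+1`!%:R = (hermite R n.+1).[x] by rewrite Ha => -[].
elim: n => [|n [IH0 IH1]].
  (* The constant term of the series is its value at z = 0. *)
  have a0 : a 0 = 1.
    have := cvg_unique _ (@cvg_pseries0 R a) (ha 0).
    by rewrite mulr0 expr0n/= subr0 expR0; exact.
  have a1 : a 1%N = 2 * x.
    by have := hermite_coef_rec ha 0; rewrite a0 mulr0 subr0 mulr1 mul1r.
  by rewrite a0 a1 /= derivC subr0 !mulr1 hornerZ hornerX hornerC.
split => //.
have rec := hermite_coef_rec ha n.+1.
rewrite [hermite R n.+2]/= -/(hermite R n.+1) deriv_hermite.
rewrite hornerD hornerN hornerM !hornerZ hornerX -IH0 -IH1.
rewrite factS natrM mulrA [a n.+2 * _]mulrC rec factS natrM; ring.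
Qed.

(** * Integrals over the real line *)

(** The formula holds on each [[- (n + 1), n + 1]] by the fundamental theorem on
    segments; integrability of [f] lets dominated convergence pass to the whole
    line. *)
Lemma Rintegral_setT_FTC2 (R : realType) (f F : R -> R) (l l' : R) :
  continuous f -> (forall x, is_derive x (1 : R) F (f x)) ->
  (@lebesgue_measure R).-integrable setT (EFin \o f) ->
  F x @[x --> -oo] --> l -> F x @[x --> +oo] --> l' ->
  \int[lebesgue_measure]_x f x = l' - l.
Proof.
move=> cf dF intf Fl Fl'.
(* Starting at radius 1 keeps every segment nondegenerate. *)
pose I n : set R := `[- n.+1%:R, n.+1%:R]%classic.
have dFx x : derivable F x 1 by exact: ex_derive.
have cF : continuous F.
  by move=> x; apply/differentiable_continuous/derivable1_diffP.
have FTC n : (\int[lebesgue_measure]_x ((f \_ (I n)) x)%:E =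
    (F n.+1%:R - F (- n.+1%:R))%:E)%E.
  transitivity (\int[lebesgue_measure]_(x in I n) (f x)%:E)%E.
    by rewrite [RHS]integral_mkcond restrict_EFin.
  rewrite (@continuous_FTC2 _ f F) ?EFinB//.
  - by rewrite -subr_gt0 opprK addr_gt0.
  - by apply: continuous_subspaceT.
  - split => //; [exact: cvg_at_right_filter (cF _)|].
    exact: cvg_at_left_filter (cF _).
  - by move=> x _; rewrite derive1E; exact: derive_val.
have nat_oo : (n.+1%:R : R) @[n --> \oo] --> +oo.
  have := @cvgr_idn R.
  by rewrite -(cvg_shiftS (fun n => n%:R : R)).
have lim1 : (F n.+1%:R - F (- n.+1%:R))%:E @[n --> \oo] --> (l' - l)%:E.
  apply: cvg_EFin; first exact: nearW.
  apply: cvgB; first by move/cvg_pinftyP : Fl'; exact.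
  by move/cvgNy_compNP/cvg_pinftyP : Fl; exact.
have mf : measurable_fun setT f by exact: continuous_measurable_fun.
have : (\int[lebesgue_measure]_x ((f \_ (I n)) x)%:E)%E @[n --> \oo] -->
    (\int[lebesgue_measure]_x (f x)%:E)%E.
  have [] // := @dominated_convergence _ _ R lebesgue_measure setT measurableT
    (fun n x => ((f \_ (I n)) x)%:E) (EFin \o f) (fun x => `|f x|%:E).
  - move=> n; apply/measurable_EFinP.
    have mI : measurable (I n) by exact: measurable_itv.
    by apply/(measurable_restrictT _ mI); exact: measurable_funTS.
  - exact/measurable_EFinP.
  (* Pointwise the truncations are eventually equal to f. *)
  - apply: aeW => x _; apply: cvg_near_cst; near=> n.
    rewrite patchE mem_set//= /I/= in_itv/= -ler_norml.
    rewrite (le_trans (ltW (archi_boundP (normr_ge0 x))))// ler_nat.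
    near: n; exact: nbhs_infty_ge.
  - exact: integrable_norm.
  - apply: aeW => x n _; rewrite lee_fin patchE.
    by case: ifPn => //; rewrite normr0.
under eq_fun do rewrite FTC.
move=> /(cvg_unique _ lim1) e; rewrite /Rintegral -e//.
Unshelve. all: by end_near. Qed.

(** * Polynomials against a Gaussian weight *)

(** Each monomial satisfies [|x|^i <= i! exp |x|], by keeping a single term of
    the exponential series. *)
Lemma normr_horner_le_expR (R : realType) (p : {poly R}) :
  exists2 C, 0 <= C & forall x, `|p.[x]| <= C * expR `|x|.
Proof.
exists (\sum_(i < size p) `|p`_i| * i`!%:R) => [|x].
  by apply: sumr_ge0 => i _; rewrite mulr_ge0.
rewrite horner_coef mulr_suml; apply: le_trans (ler_norm_sum _ _ _) _.
apply: ler_sum => -[[|i] _] _ /=; rewrite normrM normrX -mulrA ler_wpM2l//.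
  by rewrite expr0 fact0 mul1r -expR0 ler_expR.
rewrite -ler_pdivrMl ?ltr0n ?fact_gt0// mulrC.
by apply: le_trans (expR_ge1Dxn i (normr_ge0 x)); rewrite lerDr.
Qed.

(** Half of the Gaussian exponent, [(x - m)^2 / 2], pays for the growth of the
    polynomial; the other half remains as an integrable bound. *)
Lemma normr_gauss_horner_le (R : realType) (m : R) (p : {poly R}) :
  exists2 C, 0 <= C &
  forall x, `|gauss_fun (x - m) * p.[x]| <= C * normal_fun m 1 x.
Proof.
have [C C0 pC] := normr_horner_le_expR p.
exists (C * expR (`|m| + 1 / 2)) => [|x].
  by rewrite mulr_ge0 ?expR_ge0.
rewrite normrM ger0_norm ?gauss_fun_ge0//.
apply: le_trans (ler_wpM2l (gauss_fun_ge0 _) (pC x)) _.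
rewrite mulrCA -mulrA ler_wpM2l// /gauss_fun /normal_fun -!expRD ler_expR.
have : `|x| <= `|m| + `|x - m| by rewrite -[x in leLHS](subrKC m) ler_normD.
rewrite expr1n -(real_normK (num_real (x - m))).
(* t <= t^2 / 2 + 1 / 2 for t = |x - m|. *)
by have := sqr_ge0 (`|x - m| - 1); lra.
Qed.

(** Both tails of the Gaussian are dominated by one symmetric exponential, which
    lets the limit at [-oo] be deduced from the one at [+oo]. *)
Lemma normal_fun_le_expR (R : realType) (m x : R) :
  normal_fun m 1 x <= expR (`|m| + 1 / 2) * expR (- `|x|).
Proof.
rewrite /normal_fun expr1n -expRD ler_expR.
have : `|x| <= `|m| + `|x - m| by rewrite -[x in leLHS](subrKC m) ler_normD.
rewrite -(real_normK (num_real (x - m))).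
(* t <= t^2 / 2 + 1 / 2 for t = |x - m|. *)
by have := sqr_ge0 (`|x - m| - 1); lra.
Qed.

Lemma cvgy_le_expRN (R : realType) (F : R -> R) (C : R) :
  (forall x, `|F x| <= C * expR (- `|x|)) -> F x @[x --> +oo] --> 0.
Proof.
move=> FC; apply/norm_cvg0P.
apply: (@squeeze_cvgr _ _ _ _ (fun=> 0) (fun x => C * expR (- x))).
- near=> x; rewrite normr_ge0/= (le_trans (FC x))// ger0_norm//.
- exact: cvg_cst.
- rewrite -(mulr0 C); apply: cvgMl_tmp; exact: cvgr_expR.
Unshelve. all: by end_near. Qed.

Section gaussian_weight.
Variables (R : realType) (m : R).
Local Notation mu := (@lebesgue_measure R).
Local Notation w := (fun x => gauss_fun (x - m)).

Lemma continuous_gauss_horner (p : {poly R}) :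
  continuous (fun x => w x * p.[x]).
Proof.
move=> x; apply: cvgM; last exact: continuous_horner.
apply: (@continuous_comp _ _ _ (fun x => x - m) gauss_fun).
  by apply: cvgB; [exact: cvg_id|exact: cvg_cst].
exact: continuous_gauss_fun.
Qed.

Lemma integrable_gauss_horner (p : {poly R}) :
  mu.-integrable setT (fun x => (w x * p.[x])%:E).
Proof.
have [C C0 wC] := normr_gauss_horner_le m p.
have mw : measurable_fun setT (fun x : R => w x * p.[x]).
  by apply: continuous_measurable_fun; exact: continuous_gauss_horner.
apply: (@le_integrable _ _ _ mu setT _ _
    (fun x => (C / normal_peak 1 * normal_pdf m 1 x)%:E)) => //.
- exact/measurable_EFinP.
- move=> x _; rewrite normal_pdfE ?oner_neq0//= lee_fin.
  rewrite mulrA divfK ?gt_eqF ?normal_peak_gt0 ?oner_neq0//.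
  exact: le_trans (wC x) (ler_norm _).
- under eq_fun => x do rewrite EFinM.
  by apply: integrableZl => //; exact: integrable_normal_pdf.
Qed.

Lemma Rintegral_gauss : \int[mu]_x w x = Num.sqrt pi.
Proof.
(* The weight is the unnormalized normal density of variance 1/2. *)
have s0 : (Num.sqrt 2)^-1 != 0 :> R by rewrite invr_eq0 sqrtr_eq0 -ltNge.
have s1 : (Num.sqrt 2)^-1 ^+ 2 *+ 2 = 1 :> R.
  by rewrite exprVn sqr_sqrtr// -mulr_natr mulVf.
transitivity (\int[mu]_x (Num.sqrt pi * normal_pdf m (Num.sqrt 2)^-1 x)).
  apply: eq_Rintegral => x _.
  rewrite normal_pdfE// /normal_peak /normal_fun -mulrnAl s1 mul1r divr1.
  by rewrite mulVKf// gt_eqF// sqrtr_gt0 pi_gt0.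
rewrite RintegralZl//; last exact: integrable_normal_pdf.
by rewrite /Rintegral integral_normal_pdf mulr1.
Qed.

(** The integrand is the derivative of [exp (- (x - m)^2) p(x)], which vanishes
    at both infinities. *)
Lemma Rintegral_gauss_horner_by_parts (p : {poly R}) :
  \int[mu]_x (w x * (p^`() - 2 *: ('X - m%:P) * p).[x]) = 0.
Proof.
have [C C0 wC] := normr_gauss_horner_le m p.
have bound x : `|w x * p.[x]| <= C * expR (`|m| + 1 / 2) * expR (- `|x|).
  by rewrite -mulrA (le_trans (wC x))// ler_wpM2l// normal_fun_le_expR.
transitivity (0 - 0 : R); last by rewrite subrr.
apply: (@Rintegral_setT_FTC2 _ _ (fun x => w x * p.[x])).
- exact: continuous_gauss_horner.
- move=> x.
  have -> : (fun x => w x * p.[x]) =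
      (expR \o horner (- ('X - m%:P) ^+ 2)) * horner p.
    by apply/funext => y; rewrite !fctE !hornerE.
  apply: is_derive_eq.
  rewrite expr2 derivN derivM derivB derivX derivC !hornerE /gauss_fun /=.
  by rewrite !hornerE /GRing.scale/=; ring.
- exact: integrable_gauss_horner.
- apply/cvgNy_compNP; apply: (@cvgy_le_expRN _ _ (C * expR (`|m| + 1 / 2))).
  by move=> x; rewrite -(normrN x); exact: bound.
- exact: (cvgy_le_expRN bound).
Qed.

(** Splitting [2 x = 2 (x - m) + 2 m] in [H_{n+1} = 2 x H_n - H_n'] leaves
    [2 m H_n] plus an exact derivative of zero integral. *)
Lemma Rintegral_gauss_hermite n :
  \int[mu]_x (w x * (hermite R n).[x]) = Num.sqrt pi * (2 * m) ^+ n.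
Proof.
elim: n => [|n IHn].
  rewrite expr0 mulr1 -Rintegral_gauss.
  by apply: eq_Rintegral => x _; rewrite hornerC mulr1.
transitivity (\int[mu]_x (2 * m * (w x * (hermite R n).[x])
   - w x * ((hermite R n)^`() - 2 *: ('X - m%:P) * hermite R n).[x])).
  apply: eq_Rintegral => x _ /=.
  by rewrite !(hornerD, hornerN, hornerM, hornerZ, hornerX, hornerC); ring.
rewrite RintegralB//; last 2 first.
- have -> : EFin \o (fun x => 2 * m * (w x * (hermite R n).[x])) =
      fun x => (w x * ((2 * m) *: hermite R n).[x])%:E.
    by apply/funext => x; rewrite /= hornerZ mulrCA.
  exact: integrable_gauss_horner.
- exact: integrable_gauss_horner.
rewrite Rintegral_gauss_horner_by_parts subr0 RintegralZl//.
  by rewrite IHn exprS mulrCA.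
exact: integrable_gauss_horner.
Qed.
End gaussian_weight.

(** * The convolution *)

Theorem proposition3p4 (R : realType) (H : nat -> {poly R})
    (hH : is_hermite H) (n : nat) (u : R) :
  convT H (psi_L2 H n) u = convolution (psi H 0) (psi H n) u /\
  convolution (psi H 0) (psi H n) u =
    u ^+ n / Num.sqrt (n`!%:R * 2 ^+ n) * expR (- (u ^+ 2) / 4).
Proof.
split; first by [].
set c : R := Num.sqrt (Num.sqrt pi); set d : R := Num.sqrt (n`!%:R * 2 ^+ n).
have c0 : c != 0 by rewrite gt_eqF// !sqrtr_gt0 pi_gt0.
have c2 : Num.sqrt pi = c * c by rewrite -expr2 sqr_sqrtr ?sqrtr_ge0.
have d0 : d != 0.
  by rewrite gt_eqF// sqrtr_gt0 mulr_gt0 ?exprn_gt0// ltr0n fact_gt0.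
rewrite /convolution.
(* Both psi factors carry sqrt (sqrt pi), whose product c * c cancels the total
   mass sqrt pi of the Gaussian weight. *)
transitivity (\int[lebesgue_measure]_x (expR (- u ^+ 2 / 4) / (c * (d * c)) *
    (gauss_fun (x - u / 2) * (hermite R n).[x]))).
  apply: eq_Rintegral => x _; rewrite /psi /hermite_fun !is_hermiteE// /=.
  rewrite hornerC fact0 expr0 !mul1r mulr1 sqrtrM; last first.
    by rewrite mulr_ge0 ?exprn_ge0.
  rewrite -/c -/d /gauss_fun.
  have square : expR (- (u - x) ^+ 2 / 2) * expR (- x ^+ 2 / 2) =
      expR (- u ^+ 2 / 4) * expR (- (x - u / 2) ^+ 2).
    by rewrite -!expRD; congr expR; field.
  rewrite mulrACA [X in X * _]mulrA square -invfM.
  by rewrite mulrAC -mulrA mulrACA !mulrA.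
rewrite RintegralZl//; last exact: integrable_gauss_horner.
rewrite Rintegral_gauss_hermite c2 [2 * _]mulrC divfK ?pnatr_eq0//.
by field; rewrite c0 d0.
Qed.
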